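(* For non-separated layouts (arbitrary ordered matchings), there are infinitely many pairwise non-isomorphic (i) $(s,q)$-critical ordered matchings, for all integers $s\ge 2$ and $q\ge 0$, and (ii) $k$-critical ordered matchings, for all integers $k\ge 2$.
   Context: An ordered graph is a graph with a total order $\prec$ on its vertices; an ordered matching has maximum degree at most one. Two edges $uv$, $xy$ ($u\prec v$, $x\prec y$, four distinct endpoints) cross if $u\prec x\prec v\prec y$ or $x\prec u\prec y\prec v$ and nest if $u\prec x\prec y\prec v$ or $x\prec u\prec v\prec y$. A stack (queue) is an edge set with no two crossing (nesting) edges; an $s$-stack $q$-queue layout is a partition of the edges into $s$ stacks and $q$ queues with respect to the given order, and a mixed $k$-page layout is an $s$-stack $q$-queue layout with $s+q=k$. An ordered graph $G$ is $(s,q)$-critical if it admits no $s$-stack $q$-queue layout but $G-e$ does for every edge $e$; it is $k$-critical if it admits no mixed $k$-page layout but $G-e$ does for every edge $e$. Isomorphism means order-preserving isomorphism. *)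

(* Defs.v *)
From HB Require Import structures.
From mathcomp Require Import all_boot all_order.
Set Implicit Arguments.
Unset Strict Implicit.
Unset Printing Implicit Defensive.
Import Order.TTheory.
Local Open Scope order_scope.

(* The undirected edge {u, v} is stored as the unique pair (u, v) with u < v,
   so graphs are simple and loopless by construction. *)
Record ordered_graph := OrderedGraph {
  vertex_disp : Order.disp_t;
  vertex : finOrderType vertex_disp;
  edges : {set vertex * vertex};
  edges_ordered : forall e, e \in edges -> e.1 < e.2
}.

Section Edges.
Context {d : Order.disp_t} {V : finOrderType d}.
Implicit Types (e f : V * V) (A : {set V * V}).

(* Distinctness of the four endpoints is implied by the strict chains. *)
Definition crossing e f : bool :=
  [&& e.1 < f.1, f.1 < e.2 & e.2 < f.2] ||
  [&& f.1 < e.1, e.1 < f.2 & f.2 < e.2].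

Definition nesting e f : bool :=
  [&& e.1 < f.1, f.1 < f.2 & f.2 < e.2] ||
  [&& f.1 < e.1, e.1 < e.2 & e.2 < f.2].

Definition is_stack A : Prop := {in A &, forall e f, ~~ crossing e f}.

Definition is_queue A : Prop := {in A &, forall e f, ~~ nesting e f}.

End Edges.

Lemma delete_edge_ordered (G : ordered_graph) (e0 : vertex G * vertex G) e :
  e \in edges G :\ e0 -> e.1 < e.2.
Proof. by case/setD1P => _; apply: edges_ordered. Qed.

Definition delete_edge (G : ordered_graph) (e0 : vertex G * vertex G) :=
  OrderedGraph (@delete_edge_ordered G e0).

Definition degree (G : ordered_graph) (v : vertex G) : nat :=
  #|[set e in edges G | (e.1 == v) || (e.2 == v)]|.

Definition is_matching (G : ordered_graph) : Prop :=
  forall v : vertex G, (degree v <= 1)%N.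

Definition no_isolated_vertex (G : ordered_graph) : Prop :=
  forall v : vertex G, (0 < degree v)%N.

(* A partition of the edges into s + q labelled pages, given by the map sending
   each edge to its page (values off the edge set are irrelevant).  As usual
   for page layouts, pages may be empty. *)
Definition has_layout (s q : nat) (G : ordered_graph) : Prop :=
  exists page : vertex G * vertex G -> 'I_s + 'I_q,
    (forall i : 'I_s, is_stack [set e in edges G | page e == inl i]) /\
    (forall j : 'I_q, is_queue [set e in edges G | page e == inr j]).

Definition has_mixed_layout (k : nat) (G : ordered_graph) : Prop :=
  exists s q : nat, (s + q)%N = k /\ has_layout s q G.

Definition sq_critical (s q : nat) (G : ordered_graph) : Prop :=
  ~ has_layout s q G /\
  forall e, e \in edges G -> has_layout s q (delete_edge e).

Definition k_critical (k : nat) (G : ordered_graph) : Prop :=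
  ~ has_mixed_layout k G /\
  forall e, e \in edges G -> has_mixed_layout k (delete_edge e).

Definition isomorphic (G H : ordered_graph) : Prop :=
  exists f : vertex G -> vertex H,
    [/\ bijective f,
        {mono f : u v / u < v} &
        forall u v, ((f u, f v) \in edges H) = ((u, v) \in edges G)].

Definition infinitely_many_nonisomorphic (P : ordered_graph -> Prop) : Prop :=
  exists M : nat -> ordered_graph,
    (forall i, P (M i)) /\
    (forall i j, i <> j -> ~ isomorphic (M i) (M j)).

(* Isolated vertices do not affect layouts or criticality, so padding a single
   critical matching with them would already give infinitely many isomorphism
   types.  They are excluded so that the infinitely many matchings really
   differ in their edges. *)
Definition infinitely_many_matchings (P : ordered_graph -> Prop) : Prop :=
  infinitely_many_nonisomorphic
    (fun G => [/\ is_matching G, no_isolated_vertex G & P G]).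

(* Main.v *)
(* A critical matching sits inside every matching without a layout, so it is
   enough to find matchings without a layout all of whose small submatchings
   have one: the critical matchings inside them are then arbitrarily large.

   For [s] stacks take chords whose crossing graph is an odd cycle and replace
   every other chord by [s - 1] pairwise crossing copies, giving single chords
   [e_0, ..., e_N] and cliques [B_0, ..., B_(N-1)], where [B_i] crosses exactly
   [e_i] and [e_(i+1)], and [e_0] crosses [e_N].  A clique uses [s - 1] stacks,
   which forces [e_i] and [e_(i+1)] onto the same stack; hence [e_0] and [e_N]
   would share a stack.  Once some [B_i] is absent the chain is broken and [s]
   stacks suffice.

   For [(s, q)], surround this matching with [q] nested twists of [s + 1]
   edges: each twist occupies a queue of its own, and no edge below all the
   twists fits into one of these queues.  For mixed [k]-page layouts, put next
   to it [k] pairwise crossing rainbows of [k + 1] edges: each rainbow needs a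
   stack of its own, so all [k] pages are stacks. *)
Require Import Defs.
From HB Require Import structures.
From mathcomp Require Import all_boot all_order zify.
From mathcomp Require Import boolp.
Set Implicit Arguments.
Unset Strict Implicit.
Unset Printing Implicit Defensive.
Import Order.TTheory.

(** * Ordered matchings given by chords *)

Local Notation position := (nat *l nat)%type.

(* A matching without isolated vertices, given by the positions [pos (c, false)]
   and [pos (c, true)] of the left and right endpoint of every chord [c]. *)
Record chord_system := ChordSystem {
  chord : finType;
  pos : chord * bool -> position;
  pos_inj : injective pos;
  pos_ltlr : forall c, (pos (c, false) < pos (c, true))%O
}.

Definition endpoint (C : chord_system) : Type := (chord C * bool)%type.

Section Endpoint.
Variable C : chord_system.
HB.instance Definition _ := Finite.on (endpoint C).

Definition endpoint_le (x y : endpoint C) := (pos x <= pos y)%O.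
Definition endpoint_lt (x y : endpoint C) := (pos x < pos y)%O.

Fact endpoint_lt_def x y : endpoint_lt x y = (y != x) && endpoint_le x y.
Proof. by rewrite /endpoint_lt lt_def (inj_eq (@pos_inj C)). Qed.

Fact endpoint_le_anti : antisymmetric endpoint_le.
Proof. by move=> x y /le_anti /(@pos_inj C). Qed.

Fact endpoint_le_trans : transitive endpoint_le.
Proof. by move=> x y z; apply: le_trans. Qed.

Fact endpoint_le_total : total endpoint_le.
Proof. by move=> x y; apply: le_total. Qed.

HB.instance Definition _ :=
  Order.isOrder.Build (Order.Disp tt tt) (endpoint C) endpoint_lt_def
    (fun _ _ => erefl) (fun _ _ => erefl)
    endpoint_le_anti endpoint_le_trans endpoint_le_total.

Definition chord_edge (c : chord C) : endpoint C * endpoint C :=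
  ((c, false), (c, true)).

Lemma chord_edges_ordered e :
  e \in [set chord_edge c | c : chord C] -> (e.1 < e.2)%O.
Proof. by case/imsetP => c _ ->; apply: pos_ltlr. Qed.

Definition chord_graph := OrderedGraph chord_edges_ordered.

Lemma degree_chord_graph (v : vertex chord_graph) : degree v = 1.
Proof.
rewrite -(cards1 (chord_edge v.1)); apply: eq_card => e; rewrite !inE.
apply/andP/eqP => [[/imsetP[c _ ->]]|->].
  by case/orP => /eqP <-.
split; first exact: imset_f.
by case: v => c [] /=; rewrite eqxx ?orbT.
Qed.

Lemma chord_graph_matching : is_matching chord_graph.
Proof. by move=> v; rewrite degree_chord_graph. Qed.

Lemma chord_graph_no_isolated : no_isolated_vertex chord_graph.
Proof. by move=> v; rewrite degree_chord_graph. Qed.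

Lemma card_chord_graph : #|edges chord_graph| = #|chord C|.
Proof. by rewrite card_imset // => c d []. Qed.

(** Layouts of submatchings are phrased on subsets of one fixed chord type, so that
    inclusion-minimal subsets can be taken. *)
Definition chord_layout s q (A : {set chord C}) : Prop :=
  exists page : chord C -> 'I_s + 'I_q, {in A &, forall c d, page c = page d ->
    if page c is inl _ then ~~ crossing (chord_edge c) (chord_edge d)
    else ~~ nesting (chord_edge c) (chord_edge d)}.

Lemma chord_layout_setT s q : chord_layout s q [set: chord C] ->
  exists page : chord C -> 'I_s + 'I_q,
    (forall c d i, page c = inl i -> page d = inl i ->
       ~~ crossing (chord_edge c) (chord_edge d)) /\
    (forall c d j, page c = inr j -> page d = inr j ->
       ~~ nesting (chord_edge c) (chord_edge d)).
Proof.
case=> page page_ok; exists page; split=> c d i ci di;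
  by have := page_ok c d (in_setT _) (in_setT _); rewrite ci di; apply.
Qed.

Lemma endpoint_ltE (x y : endpoint C) : (x < y)%O = (pos x < pos y)%O.
Proof. by []. Qed.

End Endpoint.

(** * Passing to a submatching *)

Section Restriction.
Variables (C : chord_system) (A : {set chord C}).

Definition restrict_pos (x : {c : chord C | c \in A} * bool) : position :=
  pos (val x.1, x.2).

Fact restrict_pos_inj : injective restrict_pos.
Proof. by move=> [c b] [d b'] /pos_inj[/val_inj-> ->]. Qed.

Fact restrict_pos_ltlr c : (restrict_pos (c, false) < restrict_pos (c, true))%O.
Proof. exact: pos_ltlr. Qed.

Definition restrict := ChordSystem restrict_pos_inj restrict_pos_ltlr.

Lemma chord_layout_restrict s q : (0 < s + q)%N ->
  has_layout s q (chord_graph restrict) -> chord_layout s q A.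
Proof.
move=> sq0 [page [pS pQ]].
(* Default page for the chords outside [A]. *)
have x0 : 'I_s + 'I_q := split (Ordinal sq0).
pose pg c := if insub c is Some c' then page (chord_edge (c' : chord restrict)) else x0.
exists pg => c d cA dA; rewrite /pg !insubT /=.
set e := chord_edge _; set f := chord_edge _ => ef.
have eE : e \in edges (chord_graph restrict) by apply: imset_f.
have fE : f \in edges (chord_graph restrict) by apply: imset_f.
case E: (page e) => [i|j].
  by apply: (pS i e f); rewrite inE ?eE ?fE -?ef E eqxx.
by apply: (pQ j e f); rewrite inE ?eE ?fE -?ef E eqxx.
Qed.

Lemma delete_restrict_layout s q (c : chord restrict) :
  chord_layout s q (A :\ val c) ->
  has_layout s q (@delete_edge (chord_graph restrict) (chord_edge c)).
Proof.
case=> page pP; exists (fun e => page (val e.1.1)).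
have memA (d : chord restrict) : d != c -> val d \in A :\ val c.
  by move=> dc; rewrite !inE (valP d) (inj_eq val_inj) dc.
have edgeP e : e \in edges (@delete_edge (chord_graph restrict) (chord_edge c)) ->
    exists2 d : chord restrict, d != c & e = chord_edge d.
  by case/setD1P => ec /imsetP[d _ ed]; exists d => //; apply: contraNneq ec => <-; apply/eqP.
split=> [i|j] e f /setIdP[/edgeP[d dc ->] /eqP pe] /setIdP[/edgeP[d' d'c ->] /eqP pf];
  by have := pP _ _ (memA _ dc) (memA _ d'c); rewrite /= in pe pf; rewrite pe pf; apply.
Qed.

End Restriction.

(** * Critical matchings of unbounded size *)

Lemma isomorphic_card (G H : ordered_graph) :
  isomorphic G H -> #|edges G| = #|edges H|.
Proof.
case=> f [[g fK gK] _ fE].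
have inj : injective (fun e : vertex G * vertex G => (f e.1, f e.2)).
  by move=> [u v] [u' v'] [/(can_inj fK)-> /(can_inj fK)->].
rewrite -(card_imset _ inj); apply: eq_card => -[u v].
apply/imsetP/idP => [[[u' v'] uv [-> ->]]|uv]; first by rewrite fE.
by exists (g u, g v); rewrite /= ?gK // -fE !gK.
Qed.

Lemma unbounded_infinitely_many (P : ordered_graph -> Prop) :
  (forall n, exists2 G, P G & n <= #|edges G|) ->
  infinitely_many_nonisomorphic P.
Proof.
move=> unb.
have /choice[F FP] n : exists G, P G /\ n <= #|edges G|.
  by have [G] := unb n; exists G.
(* Each graph has more edges than its predecessor, and the number of edges is an isomorphism
   invariant. *)
pose M := fix M i := if i is i'.+1 then F #|edges (M i')|.+1 else F 0.
have Mlt : {homo (fun i => #|edges (M i)|) : i j / i < j}.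
  by apply: homo_ltn => [|i]; [exact: ltn_trans | have [] := FP #|edges (M i)|.+1].
exists M; split=> [i|i j ij /isomorphic_card eqM]; first by case: i => [|i]; apply: (FP _).1.
by case: (ltngtP i j) ij => // /Mlt; rewrite eqM ltnn.
Qed.

(** [ok] selects the admissible page counts: the single pair [(s, q)] in (i), all pairs with sum [k]
    in (ii). *)
Definition layouts (ok : nat -> nat -> Prop) (G : ordered_graph) : Prop :=
  exists s q, ok s q /\ has_layout s q G.

Definition critical (L : ordered_graph -> Prop) (G : ordered_graph) : Prop :=
  ~ L G /\ forall e, e \in edges G -> L (delete_edge e).

Lemma infinitely_many_critical (ok : nat -> nat -> Prop) :
  (forall s q, ok s q -> 0 < s + q) ->
  (forall n, exists C, (forall s q, ok s q -> ~ chord_layout s q [set: chord C]) /\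
    forall A : {set chord C}, #|A| < n -> exists s q, ok s q /\ chord_layout s q A) ->
  infinitely_many_matchings (critical (layouts ok)).
Proof.
move=> ok0 H; apply: unbounded_infinitely_many => n.
have [C [nolay small]] := H n.
pose L (A : {set chord C}) := exists s q, ok s q /\ chord_layout s q A.
(* A minimal chord set without a layout is critical, and it has at least [n] chords because smaller
   sets have layouts. *)
have [|A /minsetP[/asboolP nA minA] _] := @minset_exists _ (fun A => `[< ~ L A >]) setT.
  by apply/asboolP => -[s [q [/nolay]]].
exists (chord_graph (restrict A)); last first.
  rewrite card_chord_graph card_sig leqNgt; apply/negP => An.
  by apply: nA; apply: small; rewrite (eq_card (B := A)) // in An.
split; [exact: chord_graph_matching | exact: chord_graph_no_isolated |].
split.
  case=> s [q [sq Lsq]]; apply: nA; exists s, q; split=> //.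
  exact/chord_layout_restrict/Lsq/ok0.
move=> _ /imsetP[c _ ->].
have [s [q [sq Lsq]]] : L (A :\ val c).
  apply: contrapT => nL; have /setP/(_ (val c)) := minA _ (asboolT nL) (subsetDl _ _).
  by rewrite !inE eqxx (valP c).
by exists s, q; split=> //; apply: delete_restrict_layout.
Qed.

(** * The cycle of cliques and its stack colourings *)

Lemma lt_position (a x b y : nat) :
  (((a, x) : position) < (b, y))%O = (a < b) || ((a == b) && (x < y)).
Proof. by rewrite ltEprodlexi /= !leEnat ltEnat; lia. Qed.

(* With [s = t.+2] stacks and [N = n.+1]: [inl i] is [e_i], and [inr (i, j)] is
   the [j]-th of the [s - 1] chords of the clique [B_i]. *)
Definition cycle_chord (t n : nat) : finType :=
  ('I_n.+2 + 'I_n.+1 * 'I_t.+1)%type.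

(* First coordinates for [N = 2]:
     B_0 = (0,3), e_1 = (2,5), B_1 = (4,7), e_2 = (6,9) and e_0 = (1,8),
   an interval path closed up by [e_0].  The second coordinate separates the
   chords of a clique; being the same at both ends, it makes them cross. *)
Definition cycle_pos t n (x : cycle_chord t n * bool) : position :=
  match x with
  | (inl i, b) =>
      (if val i is i'.+1 then (if b then 4 * i'.+1 + 1 else 4 * i'.+1 - 2)
       else (if b then 4 * n.+1 else 1), 0)
  | (inr (i, j), b) => ((if b then 4 * i + 3 else 4 * i), val j)
  end.

Definition shift_pos (h : nat) (p : position) : position := (h + p.1, p.2).

Lemma shift_pos_inj h : injective (shift_pos h).
Proof. by move=> [a x] [b y] [/addnI-> ->]. Qed.

Lemma cycle_monochromatic t n (col : cycle_chord t n -> 'I_t.+2) :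
  (forall i j j', col (inr (i, j)) = col (inr (i, j')) -> j = j') ->
  (forall (i : 'I_n.+1) j (a : 'I_n.+2), (a == i :> nat) || (a == i.+1 :> nat) ->
     col (inr (i, j)) <> col (inl a)) ->
  col (inl ord0) = col (inl ord_max).
Proof.
move=> inj adj.
have step i (a b : 'I_n.+2) : (a = i :> nat) -> (b = i.+1 :> nat) -> i < n.+1 ->
    col (inl a) = col (inl b).
  move=> ai bi i_n; apply/eqP/contraT => ab.
  pose B := [set col (inr (Ordinal i_n, j)) | j : 'I_t.+1].
  have cB : #|B| = t.+1 by rewrite card_imset ?card_ord // => j j'; apply: inj.
  (* If the two colours differed, the [t.+1] colours of the clique would lie among the [t] remaining
     ones. *)
  have /subset_leq_card : B \subset ~: [set col (inl a); col (inl b)].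
    apply/subsetP => _ /imsetP[j _ ->]; rewrite !inE; apply/norP.
    by split; apply/eqP/adj; rewrite /= ?ai ?bi eqxx ?orbT.
  by rewrite cB cardsCs setCK card_ord cards2 ab subSS subSS subn0 ltnn.
suff all m (a : 'I_n.+2) : a = m :> nat -> col (inl ord0) = col (inl a).
  exact: (all n.+1).
elim: m a => [|m IH] a am; first by congr (col (inl _)); apply: val_inj.
have m_n : m < n.+2 by rewrite -ltnS -am; apply: leqW.
rewrite (IH (Ordinal m_n)) //; apply: (step m) => //.
by rewrite -ltnS -am.
Qed.

(** A row has more entries than [X] has pages, each taking at most one of them, so some entry goes
    to [Y]; no other row uses that page. Rows will be twists with stacks as [X], or rainbows with
    queues as [X]. *)
Lemma grid_row_pages (X Y : finType) m p (page : 'I_m * 'I_p -> X + Y) :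
  #|X| < p ->
  (forall i j j' x, page (i, j) = inl x -> page (i, j') = inl x -> j = j') ->
  (forall i i' j j' y, page (i, j) = inr y -> page (i', j') = inr y -> i = i') ->
  exists2 g : 'I_m -> Y, injective g & forall i, exists j, page (i, j) = inr (g i).
Proof.
move=> Xp rowX rowY.
have /choice[g gP] i : exists y, exists j, page (i, j) = inr y.
  apply: contrapT => nY; move: Xp; apply/negP; rewrite -leqNgt.
  have /choice[f fP] j : exists x, page (i, j) = inl x.
    by case E: (page (i, j)) => [x|y]; [exists x | case: nY; exists y, j].
  rewrite -[p]card_ord; apply: (leq_card f) => j j' ff.
  by apply: (rowX i j j' (f j)); rewrite ?fP ?ff.
exists g => // i i' gg; have [j pj] := gP i; have [j' pj'] := gP i'.
by apply: (rowY i i' j j' (g i) pj); rewrite gg.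
Qed.

Section CycleGadget.
Variables (t n h : nat) (C : chord_system) (g : cycle_chord t n -> chord C).
Hypothesis pos_g : forall c b, pos (g c, b) = shift_pos h (cycle_pos (c, b)).

Lemma crossing_cycle c d :
  let l x := cycle_pos (x, false) in let r x := cycle_pos (x, true) in
  crossing (chord_edge (g c)) (chord_edge (g d)) =
    [&& l c < l d, l d < r c & r c < r d]%O || [&& l d < l c, l c < r d & r d < r c]%O.
Proof.
have lt_shift (x y : position) : (shift_pos h x < shift_pos h y)%O = (x < y)%O.
  by case: x y => [a x] [b y]; rewrite !lt_position ltn_add2l eqn_add2l.
by rewrite /crossing /= !endpoint_ltE !pos_g !lt_shift.
Qed.

Lemma crossing_in_clique i j j' : j != j' ->
  crossing (chord_edge (g (inr (i, j)))) (chord_edge (g (inr (i, j')))).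
Proof.
by rewrite -val_eqE crossing_cycle /= !lt_position; lia.
Qed.

Lemma crossing_clique_single (i : 'I_n.+1) j (a : 'I_n.+2) : 
  (a == i :> nat) || (a == i.+1 :> nat) ->
  crossing (chord_edge (g (inr (i, j)))) (chord_edge (g (inl a))).
Proof.
rewrite crossing_cycle /= !lt_position.
case: a i => [[|a] an] [i iN] /=; lia.
Qed.

Lemma crossing_ends :
  crossing (chord_edge (g (inl ord0))) (chord_edge (g (inl ord_max))).
Proof. rewrite crossing_cycle /= !lt_position; lia. Qed.

Lemma cycle_not_stackable (q : nat) (page : chord C -> 'I_t.+2 + 'I_q) :
  (forall c d i, page c = inl i -> page d = inl i ->
     ~~ crossing (chord_edge c) (chord_edge d)) ->
  (forall c, exists i, page (g c) = inl i) -> False.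
Proof.
move=> page_ok /choice[col colE].
have ok c d : col c = col d -> ~~ crossing (chord_edge (g c)) (chord_edge (g d)).
  by move=> cd; apply: page_ok (colE c) _; rewrite colE cd.
have /ok : col (inl ord0) = col (inl ord_max).
  apply: cycle_monochromatic => [i j j' /ok|i j a ia /ok].
    by apply: contraNeq; apply: crossing_in_clique.
  by rewrite crossing_clique_single.
by rewrite crossing_ends.
Qed.

(** The [n.+1] cliques are disjoint, so [n] chords cannot meet them all. *)
Lemma small_misses_clique (A : {set chord C}) : #|A| <= n ->
  exists i, forall j, g (inr (i, j)) \notin A.
Proof.
move=> An; apply: contrapT => H.
have /choice[f fP] i : exists j, g (inr (i, j)) \in A.
  apply: contrapT => ni; apply: H; exists i => j; apply/negP => ijA.
  by apply: ni; exists j.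
have inj : injective (fun i => g (inr (i, f i))).
  move=> i i' /(congr1 (fun c => pos (c, false))); rewrite !pos_g /= => -[+ _].
  by move=> ii; apply: val_inj => /=; lia.
have : #|[set g (inr (i, f i)) | i : 'I_n.+1]| <= #|A|.
  by apply/subset_leq_card/subsetP => _ /imsetP[i _ ->].
by rewrite card_imset // card_ord leqNgt ltnS An.
Qed.

(** Without [B_i], the single chords up to [e_i] can take stack 0 and the later ones stack 1, which
    separates [e_0] from [e_N]; every other clique avoids the stack of its two neighbours. *)
Lemma small_cycle_stackable (A : {set chord C}) : #|A| <= n ->
  exists col : cycle_chord t n -> 'I_t.+2, forall c d, g c \in A -> g d \in A ->
    col c = col d -> ~~ crossing (chord_edge (g c)) (chord_edge (g d)).
Proof.
move=> /small_misses_clique[i iA].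
(* Past the missing clique [B_i], the roles of stacks 0 and 1 are exchanged. *)
pose color (c : cycle_chord t n) : nat := match c with
  | inl a => i < a
  | inr (a, j) => if (a < i) || (0 < j) then j.+1 else 0
  end.
have colorP c : color c < t.+2.
  case: c => [a|[a j]] /=; first by case: (i < a).
  by case: ifP => // _; rewrite ltnS ltn_ord.
exists (fun c => inord (color c)) => c d cA dA /(congr1 val).
have neq_i a j : g (inr (a, j)) \in A -> val a != val i.
  by apply: contraTneq => /val_inj->.
rewrite /= !inordK // crossing_cycle /=.
case: c d cA dA => [a|[a j]] [b|[b k]] cA dA /=.
- case: a {cA} => [[|a] an]; case: b {dA} => [[|b] bn];
   case: i {iA neq_i color colorP} => [i iN] /=; rewrite ?lt_position; do ?case: ifP; lia.
- have := neq_i _ _ dA; case: a {cA} => [[|a] an]; case: b {dA} => [b bn];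
   case: i {iA neq_i color colorP} => [i iN] /=; rewrite ?lt_position; do ?case: ifP; lia.
- have := neq_i _ _ cA; case: a {cA} => [a an]; case: b {dA} => [[|b] bn];
   case: i {iA neq_i color colorP} => [i iN] /=; rewrite ?lt_position; do ?case: ifP; lia.
- have := neq_i _ _ cA; have := neq_i _ _ dA; case: a {cA} => [a an]; case: b {dA} => [b bn];
   case: i {iA neq_i color colorP} => [i iN] /=; rewrite ?lt_position; do ?case: ifP; lia.
Qed.
End CycleGadget.


(** * Adding twists or rainbows to the cycle *)

Section CycleWithGrid.
Variables (t n h a b : nat) (grid : 'I_a * 'I_b * bool -> position).
Hypothesis grid_inj : injective grid.
Hypothesis grid_ltlr : forall x, (grid (x, false) < grid (x, true))%O.
Hypothesis grid_out : forall x, (grid x).1 < h \/ h + 4 * n.+2 <= (grid x).1.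

Definition cycle_grid_pos (x : (cycle_chord t n + 'I_a * 'I_b) * bool) : position :=
  match x with
  | (inl c, lr) => shift_pos h (cycle_pos (c, lr))
  | (inr u, lr) => grid (u, lr)
  end.

Lemma cycle_pos_inj : injective (@cycle_pos t n).
Proof.
move=> [[[[|i] ni]|[[i ni] [j nj]]] []] [[[[|i'] ni']|[[i' ni'] [j' nj']]] []] /= E;
  move: (congr1 (fun p : position => p.1) E) (congr1 (fun p : position => p.2) E) => /= {E};
  move=> ? ?; try (exfalso; lia);
  by repeat f_equal; (apply: val_inj => /=; lia) || apply: bool_irrelevance.
Qed.

Lemma cycle_pos_bound (x : cycle_chord t n * bool) : (cycle_pos x).1 < 4 * n.+2.
Proof. by case: x => [[[[|i] ni]|[[i ni] j]] []] /=; lia. Qed.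

Fact cycle_grid_pos_inj : injective cycle_grid_pos.
Proof.
have out (c : cycle_chord t n * bool) x : shift_pos h (cycle_pos c) <> grid x.
  by move=> E; have := cycle_pos_bound c; have := grid_out x; rewrite -E /=; lia.
move=> [[c|u] lr] [[d|v] lr'].
- by move/shift_pos_inj/cycle_pos_inj => [-> ->].
- by move/out.
- by move/esym/out.
- by move/grid_inj => [-> ->].
Qed.

Fact cycle_grid_pos_ltlr c : (cycle_grid_pos (c, false) < cycle_grid_pos (c, true))%O.
Proof.
case: c => [[[[|i] ni]|[[i ni] j]]|u] //=; rewrite lt_position /=; lia.
Qed.

Arguments cycle_pos : simpl never.

Definition cycle_grid := ChordSystem cycle_grid_pos_inj cycle_grid_pos_ltlr.
End CycleWithGrid.
Arguments cycle_pos : simpl never.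

(** Reversing [i] on the right nests the rows; keeping [j] makes each row a twist. The gap of width
    [4 * n.+2] houses the cycle. *)
Definition twist_pos (n q s : nat) (x : 'I_q * 'I_s * bool) : position :=
  let: (i, j, r) := x in (if r then q + 4 * n.+2 + (q - i) else i, val j).

(** Dually, keeping [i] makes the rows cross and reversing [j] nests each row. Everything lies left
    of the cycle. *)
Definition rainbow_pos (k p : nat) (x : 'I_k * 'I_p * bool) : position :=
  let: (i, j, r) := x in if r then (k + i, p - j) else (val i, val j).

Lemma twist_pos_inj n q s : injective (@twist_pos n q s).
Proof.
move=> [[[i ni] [j nj]] []] [[[i' ni'] [j' nj']] []] /= E;
  move: (congr1 (fun p : position => p.1) E) (congr1 (fun p : position => p.2) E) => /= {E};
  move=> ? ?; try (exfalso; lia);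
  by repeat f_equal; apply: val_inj => /=; lia.
Qed.

Lemma rainbow_pos_inj k p : injective (@rainbow_pos k p).
Proof.
move=> [[[i ni] [j nj]] []] [[[i' ni'] [j' nj']] []] /= E;
  move: (congr1 (fun p : position => p.1) E) (congr1 (fun p : position => p.2) E) => /= {E};
  move=> ? ?; try (exfalso; lia);
  by repeat f_equal; apply: val_inj => /=; lia.
Qed.

Lemma twist_pos_ltlr n q s x : (@twist_pos n q s (x, false) < twist_pos n (x, true))%O.
Proof. by case: x => [[i ni] j] /=; rewrite lt_position; lia. Qed.

Lemma rainbow_pos_ltlr k p x : (@rainbow_pos k p (x, false) < rainbow_pos (x, true))%O.
Proof. by case: x => [[i ni] j] /=; rewrite lt_position; lia. Qed.

Lemma twist_pos_out n q s x :
  (@twist_pos n q s x).1 < q \/ q + 4 * n.+2 <= (twist_pos n x).1.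
Proof. by case: x => [[[i ni] j] []] /=; lia. Qed.

Lemma rainbow_pos_out n k p x :
  (@rainbow_pos k p x).1 < k + k \/ k + k + 4 * n.+2 <= (rainbow_pos x).1.
Proof. by case: x => [[[i ni] j] []] /=; lia. Qed.

Definition cycle_twists t n q s := @cycle_grid t n _ _ _ _
  (@twist_pos_inj n q s) (@twist_pos_ltlr n q s) (@twist_pos_out n q s).

Definition cycle_rainbows t n k p := @cycle_grid t n _ _ _ _
  (@rainbow_pos_inj k p) (@rainbow_pos_ltlr k p) (@rainbow_pos_out n k p).

(** * Layouts of the two combined matchings *)

Lemma cycle_twists_no_layout t n q :
  ~ chord_layout t.+2 q [set: chord (cycle_twists t n q t.+3)].
Proof.
case/chord_layout_setT => page [stack queue].
have [|i j j' x pj pj'|i i' j j' y pj pj'|g g_inj gP] :=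
  @grid_row_pages _ _ q t.+3 (fun u => page (inr u)).
- by rewrite card_ord.
- apply/eqP; apply: contraTT (stack _ _ _ pj pj') => jj'.
  rewrite negbK /crossing /= !endpoint_ltE /= !lt_position.
  case: i {pj pj'} => [i ni]; move: jj'; rewrite -val_eqE /=; lia.
- apply/eqP; apply: contraTT (queue _ _ _ pj pj') => ii'.
  rewrite negbK /nesting /= !endpoint_ltE /= !lt_position.
  case: i i' ii' {pj pj'} => [i ni] [i' ni']; rewrite -val_eqE /=; lia.
apply: (@cycle_not_stackable t n q (cycle_twists t n q t.+3) inl (fun _ _ => erefl) _ page) => // c.
case pc: (page (inl c)) => [i|y]; first by exists i.
(* An injection from the [q] twists to the [q] queues is onto, so queue [y] already holds a twist
   edge, and the cycle chord nests below it. *)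
have [g' _ g'K] := injF_bij g_inj.
have [j pj] := gP (g' y); rewrite g'K in pj.
have := queue _ _ _ pc pj.
rewrite /nesting /= !endpoint_ltE /=.
have := cycle_pos_bound (c, false); have := cycle_pos_bound (c, true).
have := pos_ltlr (inl c : chord (cycle_twists t n q t.+3)) => /=.
case: (cycle_pos _) (cycle_pos _) => [a x] [b y0]; rewrite /shift_pos /= !lt_position.
by case: (g' y) {pj} => [i ni] /= *; exfalso; lia.
Qed.

Lemma cycle_twists_small_layout t n q (A : {set chord (cycle_twists t n q t.+3)}) :
  #|A| <= n -> chord_layout t.+2 q A.
Proof.
move=> /(@small_cycle_stackable t n q (cycle_twists t n q t.+3) inl (fun _ _ => erefl))[col colP].
exists (fun c => match c with inl c => inl (col c) | inr (i, j) => inr i end).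
move=> [c|[i j]] [d|[i' j']] cA dA //= [].
  by apply: colP.
move=> <-; rewrite /nesting /= !endpoint_ltE /= !lt_position; lia.
Qed.

Lemma cycle_rainbows_no_layout t n s q : s + q = t.+2 ->
  ~ chord_layout s q [set: chord (cycle_rainbows t n t.+2 t.+3)].
Proof.
move=> sqk /chord_layout_setT[page [stack queue]].
(* Stacks and queues trade roles: a queue holds at most one edge of a rainbow. *)
pose swap (p : 'I_s + 'I_q) : 'I_q + 'I_s := match p with inl x => inr x | inr y => inl y end.
have swapl p y : swap p = inl y -> p = inr y by case: p => // x [->].
have swapr p x : swap p = inr x -> p = inl x by case: p => // y [->].
have [|i j j' x /swapl pj /swapl pj'|i i' j j' y /swapr pj /swapr pj'|g g_inj _] :=
  @grid_row_pages _ _ t.+2 t.+3 (fun u => swap (page (inr u))).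
- by rewrite card_ord; lia.
- apply/eqP; apply: contraTT (queue _ _ _ pj pj') => jj'.
  rewrite negbK /nesting /= !endpoint_ltE /= !lt_position.
  case: i {pj pj'} => [i ni]; case: j j' jj' => [j nj] [j' nj']; rewrite -val_eqE /=; lia.
- apply/eqP; apply: contraTT (stack _ _ _ pj pj') => ii'.
  rewrite negbK /crossing /= !endpoint_ltE /= !lt_position.
  case: i i' ii' {pj pj'} => [i ni] [i' ni']; rewrite -val_eqE /=; lia.
(* The [t.+2] rainbows inject into the [s] stacks, leaving no queue. *)
have := leq_card g g_inj; rewrite !card_ord => ks.
have q0 : q = 0 by lia.
have sE : s = t.+2 by lia.
subst q s.
apply: (@cycle_not_stackable t n (t.+2 + t.+2)
  (cycle_rainbows t n t.+2 t.+3) inl (fun _ _ => erefl) _ page) => // c.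
by case: (page (inl c)) => [i|[]] //; exists i.
Qed.

Lemma cycle_rainbows_small_layout t n (A : {set chord (cycle_rainbows t n t.+2 t.+3)}) :
  #|A| <= n -> chord_layout t.+2 0 A.
Proof.
move=> /(@small_cycle_stackable t n (t.+2 + t.+2)
  (cycle_rainbows t n t.+2 t.+3) inl (fun _ _ => erefl))[col colP].
(* Rainbow [i] can share stack [i] with cycle chords, as it lies entirely to their left. *)
exists (fun c => inl match c with inl c => (col c) | inr (i, j) => i end).
move=> [c|[i j]] [d|[i' j']] cA dA //= [].
- by apply: colP.
- move=> _; case: i' {dA} => [i' ni']; rewrite /crossing /= !endpoint_ltE /=.
  case: (cycle_pos _) (cycle_pos _) => [a x] [b y0]; rewrite /shift_pos /= !lt_position; lia.
- move=> _; case: i {cA} => [i ni]; rewrite /crossing /= !endpoint_ltE /=.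
  case: (cycle_pos _) (cycle_pos _) => [a x] [b y0]; rewrite /shift_pos /= !lt_position; lia.
- by move=> <-; rewrite /crossing /= !endpoint_ltE /= !lt_position; lia.
Qed.

Theorem theorem10 :
  (forall s q : nat, 2 <= s -> infinitely_many_matchings (sq_critical s q)) /\
  (forall k : nat, 2 <= k -> infinitely_many_matchings (k_critical k)).
Proof.
split=> [[|[|t]] q|[|[|t]]] // _.
  have layoutsE G : layouts (fun a b => a = t.+2 /\ b = q) G <-> has_layout t.+2 q G.
    by split=> [[a [b [[-> ->]]]]|L] //; exists t.+2, q.
  have [|n|M [MP MN]] :=
    @infinitely_many_critical (fun a b => a = t.+2 /\ b = q); first by move=> a b [->].
    exists (cycle_twists t n q t.+3); split=> [a b [-> ->]|A /ltnW An].
      exact: cycle_twists_no_layout.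
    by exists t.+2, q; split=> //; apply: cycle_twists_small_layout.
  exists M; split=> // i; have [? ? [nL dL]] := MP i; split=> //; split.
    by move/layoutsE.
  by move=> e /dL/layoutsE.
(* For this [ok], [critical (layouts ok)] unfolds to [k_critical]. *)
apply: (@infinitely_many_critical (fun a b => a + b = t.+2)) => [s q ->|n] //.
exists (cycle_rainbows t n t.+2 t.+3); split=> [s q|A /ltnW An].
  exact: cycle_rainbows_no_layout.
by exists t.+2, 0; rewrite addn0; split=> //; apply: cycle_rainbows_small_layout.
Qed.
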